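(* Consider the bi-objective problem $\min_{x\in S}f(x)$ with a data-set $\mathcal D$ of Pareto Front samples and a tolerance vector $(\delta_1,\delta_2)$ with $\delta_1,\delta_2>0$, and assume that the Pareto Front is a continuous and compact curve in $\mathbb R^2$. The following are equivalent: (i) for all $\hat{\mathcal P},\mathcal P\in FPFS_{\mathcal D}$ there is a realization $\mathcal R:\hat{\mathcal P}\to\mathcal P$ such that for every $\hat z\in\hat{\mathcal P}$, with $z^*=\mathcal R(\hat z)$ and $\varepsilon=\hat z-z^*$, one has $|\varepsilon_1|<\delta_1$ and $|\varepsilon_2|<\delta_2$; (ii) $\overline\lambda_{\mathcal D}\le\sqrt2$.
   Context: Setting. $f=(f_1,f_2):\mathbb R^n\to\mathbb R^2$, $S\subset\mathbb R^n$, $Z=\{f(x):x\in S\}$. Let $\mathbb R^2_{\succ0}$ (resp. $\mathbb R^2_{\prec0}$) be the set of nonzero vectors with non-negative (resp. non-positive) entries, and let $\oplus$ be the Minkowski sum. A point $z^{(1)}\in Z$ dominates $z^{(2)}\in Z$ iff $z^{(2)}\in\{z^{(1)}\}\oplus\mathbb R^2_{\succ0}$. The Pareto Front (PF) of the problem is the set of all non-dominated points of $Z$. The anchor points $z^{*(a1)},z^{*(a2)}$ are the PF points minimizing $f_1$, resp. $f_2$, over $S$. Data. $\mathcal D=\{z^{*(a1)},z^{*(1)},\dots,z^{*(M-2)},z^{*(a2)}\}$ is a finite set of $M\ge2$ PF points, including the anchor points, listed in strictly increasing order of the first coordinate. Transformation. $$W=\frac{\sqrt2}{2}\begin{bmatrix}1&-1\\1&1\end{bmatrix}\begin{bmatrix}1/\delta_1&0\\0&1/\delta_2\end{bmatrix}.$$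 For a point $z\in\mathbb R^2$ write $[z_v,z_q]^T=Wz$. The samples are also strictly ordered by increasing $v$-coordinate. For a function $h:[z_v^{*(a1)},z_v^{*(a2)}]\to\mathbb R$ write $W^{-1}h=\{W^{-1}[v,h(v)]^T: v\in[z_v^{*(a1)},z_v^{*(a2)}]\}$. Under the assumption on the PF, the PF equals $W^{-1}h$ for a continuous function $h$. Feasible set and bounds. For each $z^{*(j)}\in\mathcal D$ that is not an anchor point let $I^{(j)}=(\{z^{*(j)}\}\oplus\mathbb R^2_{\succ0})\cup(\{z^{*(j)}\}\oplus\mathbb R^2_{\prec0})$. For the anchor points, $I^{(a1)}$ is defined by the same formula (with $z^{*(a1)}$) together with the additional set $\{z:z_1<z_1^{*(a1)}\}$, and $I^{(a2)}$ by the same formula (with $z^{*(a2)}$) together with the additional set $\{z:z_2<z_2^{*(a2)}\}$. Let $\mathcal I_{\mathcal D}$ be the union of these sets over all points of $\mathcal D$, and $\mathcal A_{\mathcal D}=\mathbb R^2\setminus\mathcal I_{\mathcal D}$. The Feasible Pareto Function Set $FPFS_{\mathcal D}$ is the set of continuous functions $h:[z_v^{*(a1)},z_v^{*(a2)}]\to\mathbb R$ with $W^{-1}h\subset\mathcal A_{\mathcal D}$. By abuse of notation, for a curve $\mathcal P=W^{-1}h$, $\mathcal P\in FPFS_{\mathcal D}$ means $h\in FPFS_{\mathcal D}$ (and likewise for $\hat{\mathcal P}=W^{-1}\hat h$). Let $\bar h_{\mathcal D}(v)=\sup_{h\in FPFS_{\mathcal D}}h(v)$, $\underline h_{\mathcal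 D}(v)=\inf_{h\in FPFS_{\mathcal D}}h(v)$, and $$\overline\lambda_{\mathcal D}=\max_{v\in[z_v^{*(a1)},z_v^{*(a2)}]}\big(\bar h_{\mathcal D}(v)-\underline h_{\mathcal D}(v)\big).$$ A realization is simply a map $\mathcal R:\hat{\mathcal P}\to\mathcal P$ from the estimated front to the (admissible) front. *)

(* Defs.v *)
From HB Require Import structures.
From mathcomp Require Export all_boot all_order all_algebra.
From mathcomp Require Export all_classical all_reals all_analysis.

Set Implicit Arguments.
Unset Strict Implicit.
Unset Printing Implicit Defensive.

Export Order.TTheory GRing.Theory Num.Theory.
Export numFieldNormedType.Exports.

Local Open Scope classical_set_scope.
Local Open Scope ring_scope.

(* Points of R^2 are column vectors, so that W acts by *m.  The coordinates
   z_1 and z_2 of z are z 0 0 and z 1 0: indices start at 0. *)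

Section Plane.
Context {R : realType}.

Definition minkowski_sum (A B : set 'cV[R]_2) : set 'cV[R]_2 :=
  [set x + y | x in A & y in B].

Definition succ0 : set 'cV[R]_2 := [set z | z != 0 /\ forall i, 0 <= z i 0].
Definition prec0 : set 'cV[R]_2 := [set z | z != 0 /\ forall i, z i 0 <= 0].

Definition dominates (z z' : 'cV[R]_2) : Prop :=
  minkowski_sum [set z] succ0 z'.

(* A continuous curve is a continuous image of an interval of any kind
   (open, closed, bounded or not); compactness is asked for separately. *)
Definition continuous_curve (C : set 'cV[R]_2) : Prop :=
  exists (I : interval R) (gamma : R -> 'cV[R]_2),
    {within [set` I], continuous gamma} /\ C = gamma @` [set` I].

End Plane.

Section BiObjective.
Context {R : realType} {n : nat}.
Variables (f : 'cV[R]_n -> 'cV[R]_2) (S : set 'cV[R]_n).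

Definition pareto_front : set 'cV[R]_2 :=
  [set z | (f @` S) z /\ forall z', (f @` S) z' -> ~ dominates z' z].

Definition anchor_point (i : 'I_2) (z : 'cV[R]_2) : Prop :=
  pareto_front z /\ forall x, S x -> z i 0 <= f x i 0.

(* za1 :: rcons zs za2 is the data set, listed by increasing z_1; zs holds the
   M - 2 samples other than the anchor points, so M >= 2 holds by construction. *)
Definition pareto_data (za1 : 'cV[R]_2) (zs : seq 'cV[R]_2) (za2 : 'cV[R]_2)
    : Prop :=
  [/\ anchor_point 0 za1, anchor_point 1 za2,
      forall z, z \in zs -> pareto_front z &
      sorted (fun z z' : 'cV[R]_2 => z 0 0 < z' 0 0) (za1 :: rcons zs za2)].

End BiObjective.

Section Transformation.
Context {R : realType}.
Variables d1 d2 : R.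

Definition mx22 (a b c d : R) : 'M[R]_2 :=
  \matrix_(i < 2, j < 2)
    if i == 0 then (if j == 0 then a else b) else (if j == 0 then c else d).

Definition col2 (a b : R) : 'cV[R]_2 := \col_(i < 2) if i == 0 then a else b.

Definition Wmx : 'M[R]_2 :=
  (Num.sqrt 2 / 2) *: (mx22 1 (-1) 1 1 *m mx22 d1^-1 0 0 d2^-1).

Definition vcoord (z : 'cV[R]_2) : R := (Wmx *m z) 0 0.

Definition vrange (za1 za2 : 'cV[R]_2) : set R :=
  `[vcoord za1, vcoord za2]%classic.

(* W^{-1} h, for h on vrange za1 za2; the values of h elsewhere are irrelevant. *)
Definition Winv_curve (za1 za2 : 'cV[R]_2) (h : R -> R) : set 'cV[R]_2 :=
  [set invmx Wmx *m col2 v (h v) | v in vrange za1 za2].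

End Transformation.

Section Feasible.
Context {R : realType}.
Variables (za1 : 'cV[R]_2) (zs : seq 'cV[R]_2) (za2 : 'cV[R]_2).

Definition infeasible_at (z : 'cV[R]_2) : set 'cV[R]_2 :=
  minkowski_sum [set z] succ0 `|` minkowski_sum [set z] prec0.

Definition infeasible : set 'cV[R]_2 :=
  (infeasible_at za1 `|` [set z | z 0 0 < za1 0 0])
  `|` (\bigcup_(z in [set` zs]) infeasible_at z)
  `|` (infeasible_at za2 `|` [set z | z 1 0 < za2 1 0]).

Definition admissible : set 'cV[R]_2 := ~` infeasible.

Variables d1 d2 : R.

Definition FPFS : set (R -> R) :=
  [set h | {within vrange d1 d2 za1 za2, continuous h} /\
           Winv_curve d1 d2 za1 za2 h `<=` admissible].

Definition hupper (v : R) : \bar R := ereal_sup [set (h v)%:E | h in FPFS].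
Definition hlower (v : R) : \bar R := ereal_inf [set (h v)%:E | h in FPFS].

(* For Pareto data the supremum is a maximum: in the rotated coordinates the
   admissible set is a chain of rectangles, and hupper - hlower is
   finite, continuous and piecewise linear.  Extended reals avoid the default
   value of sup on unbounded sets. *)
Definition max_gap : \bar R :=
  ereal_sup [set (hupper v - hlower v)%E
            | v in vrange d1 d2 za1 za2].

End Feasible.

(* Main.v *)
(** In the rotated coordinates (v, q) a point is incomparable to a sample
    (x_i, y_i) iff |q - y_i| < |v - x_i|, and the box |eps_i| < delta_i is the
    l^1 ball |v| + |q| < sqrt 2.  Hence every feasible function passes through
    the samples and lies strictly between the envelopes
    L v = max_i (y_i - |v - x_i|) and U v = min_i (y_i + |v - x_i|) elsewhere,
    while (1 - t) L + t U is feasible for 0 < t < 1.  Both (i) and (ii) say that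
    U - L <= sqrt 2.  If this holds, projection along v is a realization, the
    strictness coming from the strict inequalities above.  Conversely, a
    realization from hhat = t L + (1 - t) U to h = (1 - t) L + t U yields w with
    |v - w| + |hhat v - h w| < sqrt 2; as h is 1-Lipschitz,
    (1 - 2 t) (U v - L v) = hhat v - h v < sqrt 2, and t tends to 0. *)

Require Import Defs.
From mathcomp Require Import all_boot all_order all_algebra.
From mathcomp Require Import all_classical all_reals all_analysis.
From mathcomp Require Import ring lra.
Import Order.TTheory GRing.Theory Num.Theory.
Import numFieldNormedType.Exports.
Local Open Scope classical_set_scope.
Local Open Scope ring_scope.

(** * Extremal 1-Lipschitz functions through finitely many points of the plane *)

Section Envelopes.
Context {R : realType} {T : eqType}.
Variables (x y : T -> R) (a : T) (s : seq T).

(** For 1-Lipschitz data, the two envelopes are the McShane-Whitney extensions, the largest and the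
    smallest 1-Lipschitz interpolants. The default value of the fold is the term of [a], which is
    itself in the range, so the extremum is one over a nonempty list. *)
Definition upper_envelope (v : R) : R :=
  \big[Num.min/y a + `|v - x a|]_(i <- a :: s) (y i + `|v - x i|).

Definition lower_envelope (v : R) : R :=
  \big[Num.max/y a - `|v - x a|]_(i <- a :: s) (y i - `|v - x i|).

Definition interpolant (t v : R) : R :=
  (1 - t) * lower_envelope v + t * upper_envelope v.

Definition in_cones (v q : R) : Prop := {in a :: s, forall i,
  (v = x i /\ q = y i) \/ `|q - y i| < `|v - x i|}.

Lemma upper_envelope_le (i : T) (v : R) :
  i \in a :: s -> upper_envelope v <= y i + `|v - x i|.
Proof. by move=> si; apply: ge_bigmin_seq. Qed.

Lemma lower_envelope_ge (i : T) (v : R) :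
  i \in a :: s -> y i - `|v - x i| <= lower_envelope v.
Proof. by move=> si; apply: (@le_bigmax_seq _ _ _ (a :: s) _ i). Qed.

(** A minimum of 1-Lipschitz functions is 1-Lipschitz. The one-sided bound is enough, since [v] and
    [w] can be exchanged. *)
Lemma lipschitz_upper_envelope (v w : R) :
  upper_envelope v - upper_envelope w <= `|v - w|.
Proof.
rewrite lerBlDl -lerBlDr [in leRHS]/upper_envelope big_seq.
have H i : i \in a :: s -> upper_envelope v - `|v - w| <= y i + `|w - x i|.
  move=> /(upper_envelope_le i v); have := ler_distD w v (x i); lra.
by apply: le_bigmin => //; apply: H; rewrite mem_head.
Qed.

Lemma lipschitz_lower_envelope (v w : R) :
  lower_envelope v - lower_envelope w <= `|v - w|.
Proof.
rewrite lerBlDl [in leLHS]/lower_envelope big_seq.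
have H i : i \in a :: s -> y i - `|v - x i| <= lower_envelope w + `|v - w|.
  move=> /(lower_envelope_ge i w); have := ler_distD v w (x i).
  rewrite (distrC w v); lra.
by apply: bigmax_le => //; apply: H; rewrite mem_head.
Qed.

Lemma lipschitz_interpolant (t v w : R) : 0 <= t <= 1 ->
  interpolant t v - interpolant t w <= `|v - w|.
Proof.
move=> /andP[t0 t1]; rewrite /interpolant.
have := lipschitz_lower_envelope v w; have := lipschitz_upper_envelope v w.
by nra.
Qed.

Lemma continuous_interpolant (t : R) : 0 <= t <= 1 -> continuous (interpolant t).
Proof.
move=> t01 v; apply/cvgrPdist_le => e e0; near=> w.
have : `|v - w| <= e by near: w; apply: (@cvgr_dist_le _ _ _ (nbhs v)).
apply: le_trans; rewrite ler_norml lerNl opprB [in X in X && _]distrC.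
by rewrite !lipschitz_interpolant.
Unshelve. all: by end_near. Qed.

Lemma in_cones_le_upper (v q : R) : in_cones v q -> q <= upper_envelope v.
Proof.
move=> vq; rewrite /upper_envelope big_seq.
have H i : i \in a :: s -> q <= y i + `|v - x i|.
  by move=> /vq[[-> ->]|/ltr_normlP[]]; [rewrite subrr normr0 addr0|lra].
by apply: le_bigmin => //; apply: H; rewrite mem_head.
Qed.

Lemma in_cones_ge_lower (v q : R) : in_cones v q -> lower_envelope v <= q.
Proof.
move=> vq; rewrite /lower_envelope big_seq.
have H i : i \in a :: s -> y i - `|v - x i| <= q.
  by move=> /vq[[-> ->]|/ltr_normlP[]]; [rewrite subrr normr0 subr0|lra].
by apply: bigmax_le => //; apply: H; rewrite mem_head.
Qed.

(** Away from the samples no apex is available, and a strict bound by each of finitely many terms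
    passes to their minimum. *)
Lemma in_cones_lt_upper (v q : R) : {in a :: s, forall i, v != x i} ->
  in_cones v q -> q < upper_envelope v.
Proof.
move=> vx vq; rewrite /upper_envelope big_seq.
have H i : i \in a :: s -> q < y i + `|v - x i|.
  move=> si; case: (vq i si) => [[/eqP]|/ltr_normlP[]]; last lra.
  by rewrite (negPf (vx i si)).
by apply: lt_bigmin => //; apply: H; rewrite mem_head.
Qed.

Hypothesis x_steep :
  {in a :: s &, forall i j, i != j -> `|y i - y j| < `|x i - x j|}.

(** By [x_steep] each sample lies in the cones of all the samples, hence between the envelopes,
    while its own term bounds both envelopes from the other side. *)
Lemma lower_upper_sample (i : T) : i \in a :: s ->
  lower_envelope (x i) = y i /\ upper_envelope (x i) = y i.
Proof.
move=> si; have ci : in_cones (x i) (y i).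
  by move=> j sj; have [->|/(x_steep _ _ si sj)] := eqVneq i j; [left|right].
have := upper_envelope_le i (x i) si; have := lower_envelope_ge i (x i) si.
rewrite subrr normr0 addr0 subr0 => L U; split; apply/eqP; rewrite eq_le.
  by rewrite L in_cones_ge_lower.
by rewrite U in_cones_le_upper.
Qed.

Lemma lower_lt_upper (v : R) : {in a :: s, forall i, v != x i} ->
  lower_envelope v < upper_envelope v.
Proof.
move=> vx; rewrite [upper_envelope v]big_seq.
(* For distinct samples this is [x_steep] followed by the triangle inequality through [v]; for equal
   ones the gap is twice the positive distance from [v] to [x i]. *)
have H i j : i \in a :: s -> j \in a :: s ->
    y i - `|v - x i| < y j + `|v - x j|.
  move=> si sj; have [<-|/(x_steep _ _ si sj)] := eqVneq i j.
    have := vx i si; rewrite -subr_eq0 -normr_gt0; lra.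
  move=> /ltr_normlP[_]; have := ler_distD v (x i) (x j).
  by rewrite (distrC (x i) v); lra.
have K j : j \in a :: s -> lower_envelope v < y j + `|v - x j|.
  move=> sj; rewrite /lower_envelope big_seq.
  by apply: bigmax_lt => [|i si]; apply: H => //; rewrite mem_head.
by apply: lt_bigmin => //; apply: K; rewrite mem_head.
Qed.

Lemma in_cones_interpolant (t v : R) : 0 < t < 1 -> in_cones v (interpolant t v).
Proof.
move=> /andP[t0 t1].
have [/hasP[i si /eqP ->]|/hasPn vx] := boolP (has (fun i => v == x i) (a :: s)).
  have [Li Ui] := lower_upper_sample i si; move=> j sj.
  have -> : interpolant t (x i) = y i by rewrite /interpolant Li Ui; lra.
  by have [->|/(x_steep _ _ si sj)] := eqVneq i j; [left|right].
move=> i si; right; have LU := lower_lt_upper v vx.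
have := upper_envelope_le i v si; have := lower_envelope_ge i v si.
rewrite /interpolant ltr_norml => *; apply/andP; split; nra.
Qed.

(** Over a sample both values equal the sample value, and positivity of [l] gives strictness.
    Elsewhere both lie at or above the lower envelope and strictly below the upper one. *)
Lemma in_cones_dist_lt (v q q' l : R) : 0 < l ->
  upper_envelope v - lower_envelope v <= l ->
  in_cones v q -> in_cones v q' -> `|q - q'| < l.
Proof.
move=> l0 UL vq vq'.
have [/hasP[i si /eqP vi]|/hasPn vx] := boolP (has (fun i => v == x i) (a :: s)).
  have E r : in_cones v r -> r = y i.
    by move=> /(_ i si)[[]//|]; rewrite vi subrr normr0 normr_lt0.
  by rewrite (E _ vq) (E _ vq') subrr normr0.
have := in_cones_lt_upper v q vx vq; have := in_cones_lt_upper v q' vx vq'.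
have := in_cones_ge_lower v q vq; have := in_cones_ge_lower v q' vq'.
by move=> *; rewrite ltr_norml; apply/andP; split; lra.
Qed.

End Envelopes.

(** * Coordinates in the plane and the rotation by [Wmx] *)

Lemma ord2P (i : 'I_2) : i = 0 \/ i = 1.
Proof. by case: i => [[|[|//]] ?]; [left|right]; apply: val_inj. Qed.

Lemma sum_ord2 (V : nmodType) (F : 'I_2 -> V) : \sum_(i < 2) F i = F 0 + F 1.
Proof.
by rewrite !big_ord_recl big_ord0 addr0; congr (F _ + F _); apply: val_inj.
Qed.

(* In [succ0] and [prec0] the test [z != 0] is elaborated at the function type
   'I_2 -> 'I_1 -> R, through the coercion of matrices to functions. *)
Lemma fun_of_matrix_neq0 {R : realType} (z : 'cV[R]_2) :
  ((fun_of_matrix z : 'I_2 -> 'I_1 -> R) != 0) <-> z <> 0.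
Proof.
split=> [/eqP fz0 z0|z0].
  by apply: fz0; apply/funext => i; apply/funext => j; rewrite z0 mxE.
by apply/eqP => fz0; apply: z0; apply/matrixP => i j; rewrite fz0 mxE.
Qed.

Lemma succ0E {R : realType} (z : 'cV[R]_2) :
  succ0 z <-> z <> 0 /\ forall i, 0 <= z i 0.
Proof. by rewrite -fun_of_matrix_neq0. Qed.

Lemma prec0E {R : realType} (z : 'cV[R]_2) :
  prec0 z <-> z <> 0 /\ forall i, z i 0 <= 0.
Proof. by rewrite -fun_of_matrix_neq0. Qed.

Section RotatedCoordinates.
Context {R : realType}.
Variables (d1 d2 : R).
Hypotheses (d1_gt0 : 0 < d1) (d2_gt0 : 0 < d2).
Implicit Types z p : 'cV[R]_2.

Let c : R := Num.sqrt 2 / 2.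

Definition qcoord z : R := (Wmx d1 d2 *m z) 1 0.

Let c_gt0 : 0 < c. Proof. by rewrite divr_gt0 ?sqrtr_gt0. Qed.
Let c2 : c * 2 = Num.sqrt 2. Proof. by rewrite divfK. Qed.

Lemma vcoordE z : vcoord d1 d2 z = c * (z 0 0 / d1 - z 1 0 / d2).
Proof.
rewrite /vcoord /Wmx -scalemxAl mxE -mulmxA; congr (_ * _).
by rewrite !mxE !sum_ord2 !mxE !sum_ord2 !mxE /=; ring.
Qed.

Lemma qcoordE z : qcoord z = c * (z 0 0 / d1 + z 1 0 / d2).
Proof.
rewrite /qcoord /Wmx -scalemxAl mxE -mulmxA; congr (_ * _).
by rewrite !mxE !sum_ord2 !mxE !sum_ord2 !mxE /=; ring.
Qed.

Lemma Wmx_unit : Wmx d1 d2 \in unitmx.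
Proof.
have det22 k l m n : \det (mx22 k l m n : 'M[R]_2) = k * n - l * m.
  rewrite (expand_det_row _ 0) sum_ord2 /cofactor !det_mx11 !mxE /=.
  by rewrite expr0 expr1; ring.
rewrite unitmxE unitfE /Wmx detZ det_mulmx !det22 !mulf_neq0 ?gt_eqF //.
by rewrite mulr0 subr0 mulr_gt0 ?invr_gt0.
Qed.

Lemma Wmx_col2 z v q :
  z = invmx (Wmx d1 d2) *m col2 v q <-> vcoord d1 d2 z = v /\ qcoord z = q.
Proof.
split=> [->|[<- <-]].
  by rewrite /vcoord /qcoord mulKVmx ?Wmx_unit // !mxE.
rewrite -[LHS](mulKmx Wmx_unit); congr (_ *m _); apply/colP => i.
by rewrite [RHS]mxE; have [->|->] := ord2P i.
Qed.

Lemma vqcoord_inj z p :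
  vcoord d1 d2 z = vcoord d1 d2 p -> qcoord z = qcoord p -> z = p.
Proof.
move=> vE qE; rewrite [RHS]((Wmx_col2 p _ _).2 (conj erefl erefl)).
exact/Wmx_col2.
Qed.

Lemma Winv_curveP za1 za2 h z :
  Winv_curve d1 d2 za1 za2 h z <->
  vrange d1 d2 za1 za2 (vcoord d1 d2 z) /\ qcoord z = h (vcoord d1 d2 z).
Proof.
split=> [[v vr /esym/Wmx_col2[-> ->]]//|[vr qE]].
by exists (vcoord d1 d2 z) => //; apply/esym/Wmx_col2.
Qed.

Lemma vcoordB z p : vcoord d1 d2 z - vcoord d1 d2 p =
  c * ((z 0 0 - p 0 0) / d1 - (z 1 0 - p 1 0) / d2).
Proof. by rewrite !vcoordE; ring. Qed.

Lemma qcoordB z p : qcoord z - qcoord p =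
  c * ((z 0 0 - p 0 0) / d1 + (z 1 0 - p 1 0) / d2).
Proof. by rewrite !qcoordE; ring. Qed.

Lemma infeasible_atE p z : infeasible_at p z <->
  z <> p /\ ((p 0 0 <= z 0 0 /\ p 1 0 <= z 1 0) \/
             (z 0 0 <= p 0 0 /\ z 1 0 <= p 1 0)).
Proof.
split.
  have shift (y : 'cV[R]_2) : y <> 0 -> p + y <> p.
    by move=> y0 /eqP; rewrite addrC -subr_eq0 addrK => /eqP.
  case=> -[_ -> [y]].
    move=> /succ0E[/shift py y_ge0] <-; split=> //; left.
    by rewrite !mxE !lerDl !y_ge0.
  move=> /prec0E[/shift py y_le0] <-; split=> //; right.
  by rewrite !mxE !gerDl !y_le0.
move=> [zp]; have subz : p + (z - p) = z by rewrite addrC subrK.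
have zp0 : z - p <> 0 by move/eqP; rewrite subr_eq0 => /eqP.
case=> -[l0 l1]; [left|right]; exists p => //; exists (z - p) => //;
  [apply/succ0E|apply/prec0E]; split=> // i;
  by rewrite !mxE ?subr_ge0 ?subr_le0; have [->|->] := ord2P i.
Qed.

(** After squaring, this says that the product of [k] and [l] is non-negative. With [k] and [l] the
    scaled coordinate differences of two points, it turns comparability into a cone condition in (v,
    q). *)
Lemma norm_subD_le (k l : R) : `|k - l| <= `|k + l| <->
  (0 <= k /\ 0 <= l) \/ (k <= 0 /\ l <= 0).
Proof.
rewrite ler_norml; split=> [/andP[]|].
  by case: (ger0P (k + l)) => ? ? ?; [left|right]; split; lra.
move=> H; have := ler_norm (k + l); have := ler_norm (- (k + l)); rewrite normrN.
by case: H => -[? ?] ? ?; apply/andP; split; lra.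
Qed.

(** The left-hand sum is twice the maximum of |k| and |l|. The factor [c] of the rotation later
    turns the 2 into sqrt 2. *)
Lemma norm_subD_lt2 (k l : R) : `|k - l| + `|k + l| < 2 <-> `|k| < 1 /\ `|l| < 1.
Proof.
split.
  by case: (ger0P (k - l)); case: (ger0P (k + l)); move=> *; split; rewrite ltr_norml;
    apply/andP; split; lra.
rewrite !ltr_norml => -[/andP[? ?] /andP[? ?]].
by case: (ger0P (k - l)); case: (ger0P (k + l)); lra.
Qed.

Lemma infeasible_atP p z : infeasible_at p z <-> z <> p /\
  `|vcoord d1 d2 z - vcoord d1 d2 p| <= `|qcoord z - qcoord p|.
Proof.
rewrite infeasible_atE vcoordB qcoordB !(normrM c) ler_pM2l ?normr_gt0 ?gt_eqF //.
rewrite norm_subD_le !pmulr_lge0 ?pmulr_lle0 ?invr_gt0 //.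
by rewrite !subr_ge0 !subr_le0.
Qed.

Lemma boxP z p : `|(z - p) 0 0| < d1 /\ `|(z - p) 1 0| < d2 <->
  `|vcoord d1 d2 z - vcoord d1 d2 p| + `|qcoord z - qcoord p| < Num.sqrt 2.
Proof.
rewrite vcoordB qcoordB !(normrM c) -mulrDr gtr0_norm // -c2 ltr_pM2l //.
rewrite norm_subD_lt2 !normrM !normfV !(gtr0_norm d1_gt0) !(gtr0_norm d2_gt0).
by rewrite !ltr_pdivrMr // !mul1r !mxE.
Qed.

Variables (za1 : 'cV[R]_2) (zs : seq 'cV[R]_2) (za2 : 'cV[R]_2).

Lemma FPFSP h : FPFS za1 zs za2 d1 d2 h <->
  {within vrange d1 d2 za1 za2, continuous h} /\
  forall v, vrange d1 d2 za1 za2 v ->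
    in_cones (vcoord d1 d2) qcoord za1 (rcons zs za2) v (h v).
Proof.
split=> -[hc H]; split=> //.
  move=> v vr p.
  have [z zE] : exists z, z = invmx (Wmx d1 d2) *m col2 v (h v) by eexists.
  have /H nz : Winv_curve d1 d2 za1 za2 h z by exists v.
  have [vE qE] := (Wmx_col2 z v (h v)).1 zE.
  move=> ps; have np : ~ infeasible_at p z.
    apply: contra_not nz; move: ps; rewrite inE mem_rcons inE.
    move=> /or3P[/eqP->|/eqP->|ps] pz; [by left; left; left|by right; left|].
    by left; right; exists p.
  have [<-|/eqP zp] := eqVneq z p; first by left.
  right; rewrite ltNge -qE -vE; apply/negP => le_vq.
  by apply: np; apply/infeasible_atP.
move=> z /Winv_curveP[vr qE].
have np p : p \in za1 :: rcons zs za2 -> ~ infeasible_at p z.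
  move=> ps /infeasible_atP[zp]; rewrite leNgt => /negP; apply; rewrite qE.
  have [[v_p q_p]|//] := H _ vr p ps.
  by case: zp; apply: vqcoord_inj; rewrite ?qE.
have np1 := np za1 (mem_head _ _).
have np2 : ~ infeasible_at za2 z by apply: np; rewrite inE mem_rcons mem_head orbT.
(* The half-planes at the anchors: as v is at least that of [za1], a point with smaller first
   coordinate than [za1] cannot have a larger second one, so it is comparable to [za1]. The same
   argument at the other end of the range handles [za2]. *)
have /andP[] := vr; rewrite !bnd_simp => v1 v2.
rewrite -subr_ge0 vcoordB pmulr_rge0 // subr_ge0 in v1.
rewrite -subr_ge0 vcoordB pmulr_rge0 // subr_ge0 in v2.
case=> [[[//|/= z1]|[p ps]]|[//|/= z2]].
- apply: np1; apply/infeasible_atE; split=> [zE|].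
    by rewrite zE ltxx in z1.
  right; split; first exact: ltW.
  rewrite -subr_le0 -(pmulr_lle0 _ (_ : 0 < d2^-1)) ?invr_gt0 //.
  by apply: le_trans v1 _; rewrite pmulr_lle0 ?invr_gt0 // subr_le0 ltW.
- by apply: np; rewrite inE mem_rcons inE ps !orbT.
- apply: np2; apply/infeasible_atE; split=> [zE|].
    by rewrite zE ltxx in z2.
  right; split; last exact: ltW.
  rewrite -subr_ge0 -(pmulr_lge0 _ (_ : 0 < d1^-1)) ?invr_gt0 //.
  apply: le_trans v2; rewrite pmulr_lge0 ?invr_gt0 // subr_ge0 ltW //.
Qed.

End RotatedCoordinates.

(** * Pareto samples and the equivalence *)

(** Of two distinct comparable points of the front one would dominate the other; negating the
    difference vector reduces [prec0] to [succ0] with the roles exchanged. *)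
Lemma pareto_front_incomparable (R : realType) (n : nat)
    (f : 'cV[R]_n -> 'cV[R]_2) (S : set 'cV[R]_n) (z p : 'cV[R]_2) :
  pareto_front f S z -> pareto_front f S p -> ~ infeasible_at p z.
Proof.
move=> [Zz Nz] [Zp Np] [/Nz|[_ -> [y /prec0E[y0 y_le0] pyz]]]; first exact.
apply: (Np z Zz); exists z => //; exists (- y); last by rewrite -pyz addrK.
by apply/succ0E; split=> [/eqP|i]; [rewrite oppr_eq0 => /eqP|rewrite mxE oppr_ge0].
Qed.

Lemma pareto_data_front (R : realType) (n : nat)
    (f : 'cV[R]_n -> 'cV[R]_2) (S : set 'cV[R]_n) za1 zs za2 :
  pareto_data f S za1 zs za2 ->
  {in za1 :: rcons zs za2, forall p, pareto_front f S p}.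
Proof.
move=> [[P1 _] [P2 _] Pz _] p.
by rewrite inE mem_rcons inE => /or3P[/eqP->|/eqP->|/Pz].
Qed.

Lemma le_of_shrunk (R : realFieldType) (k l : R) : 0 <= l ->
  (forall t, 0 < t -> t < 1 / 2 -> (1 - 2 * t) * k <= l) -> k <= l.
Proof.
move=> l0 H; rewrite leNgt; apply/negP => lk; have k0 : 0 < k by lra.
(* This t makes (1 - 2 t) k the midpoint of [k] and [l], which would exceed [l]. *)
have := H ((k - l) / (4 * k)); rewrite divr_gt0 ?subr_gt0 ?mulr_gt0 //.
have -> : (1 - 2 * ((k - l) / (4 * k))) * k = (k + l) / 2 by field; rewrite gt_eqF.
rewrite ltr_pdivrMr ?mulr_gt0 // => /(_ isT); lra.
Qed.

Theorem theorem2 (R : realType) (n : nat)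
    (f : 'cV[R]_n -> 'cV[R]_2) (S : set 'cV[R]_n)
    (za1 : 'cV[R]_2) (zs : seq 'cV[R]_2) (za2 : 'cV[R]_2) (d1 d2 : R)
    (d1_gt0 : 0 < d1) (d2_gt0 : 0 < d2)
    (PF_curve : continuous_curve (pareto_front f S))
    (PF_compact : compact (pareto_front f S))
    (data : pareto_data f S za1 zs za2) :
  (forall hhat h : R -> R,
     FPFS za1 zs za2 d1 d2 hhat -> FPFS za1 zs za2 d1 d2 h ->
     exists rho : 'cV[R]_2 -> 'cV[R]_2,
       set_fun (Winv_curve d1 d2 za1 za2 hhat) (Winv_curve d1 d2 za1 za2 h) rho /\
       forall zhat, Winv_curve d1 d2 za1 za2 hhat zhat ->
         let eps := zhat - rho zhat in
         `|eps 0 0| < d1 /\ `|eps 1 0| < d2)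
  <-> (max_gap za1 zs za2 d1 d2 <= (Num.sqrt 2)%:E)%E.
Proof.
pose vc := vcoord d1 d2; pose qc := qcoord d1 d2.
pose U := upper_envelope vc qc za1 (rcons zs za2).
pose L := lower_envelope vc qc za1 (rcons zs za2).
pose H := interpolant vc qc za1 (rcons zs za2).
(* Incomparability of the samples, read in rotated coordinates, is the hypothesis [x_steep] of the
   envelopes. *)
have steep : {in za1 :: rcons zs za2 &, forall p z,
    p != z -> `|qc p - qc z| < `|vc p - vc z|}.
  move=> p z sp sz /eqP pz; rewrite ltNge; apply/negP => le_vq.
  apply: (@pareto_front_incomparable _ _ f S p z).
  - exact: pareto_data_front data _ sp.
  - exact: pareto_data_front data _ sz.
  - exact/(infeasible_atP _ _ d1_gt0 d2_gt0).
have sqrt2_gt0 : 0 < Num.sqrt 2 :> R by rewrite sqrtr_gt0.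
have FPFS_H t : 0 < t < 1 -> FPFS za1 zs za2 d1 d2 (H t).
  move=> t01; apply/FPFSP => //; split; last by move=> v _; apply: in_cones_interpolant.
  apply: continuous_subspaceT; apply: continuous_interpolant.
  by case/andP: t01 => /ltW -> /ltW ->.
have HB t v : H (1 - t) v - H t v = (1 - 2 * t) * (U v - L v).
  by rewrite /H /interpolant -/U -/L; ring.
split=> [real|gap].
  apply/ereal_supP => _ [v vr <-].
  have UL : U v - L v <= Num.sqrt 2.
    apply: le_of_shrunk => [|t t0 t1]; first exact: ltW.
    have [||rho [rhoP rho_lt]] := real (H (1 - t)) (H t);
      [by apply: FPFS_H; lra|by apply: FPFS_H; lra|].
    have [z zE] : exists z, z = invmx (Wmx d1 d2) *m col2 v (H (1 - t) v) by eexists.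
    have [vE qE] := (Wmx_col2 _ _ d1_gt0 d2_gt0 _ _ _).1 zE.
    have zC : Winv_curve d1 d2 za1 za2 (H (1 - t)) z by exists v.
    have /(boxP _ _ d1_gt0 d2_gt0) := rho_lt z zC.
    have /(Winv_curveP _ _ d1_gt0 d2_gt0)[_ ->] := rhoP z zC.
    rewrite vE qE -HB; set w := vcoord d1 d2 (rho z) => lt_box.
    have t01 : 0 <= t <= 1 by lra.
    have := lipschitz_interpolant vc qc za1 (rcons zs za2) t w v t01.
    rewrite distrC -/(H t); have := ler_norm (H (1 - t) v - H t w); lra.
  (* All feasible functions lie between [L] and [U], so the pointwise supremum and infimum do
     too. *)
  rewrite (le_trans _ (_ : (U v)%:E - (L v)%:E <= _)%E) // leeB //.
    apply/ereal_supP => _ [h /(FPFSP _ _ d1_gt0 d2_gt0)[_ hP] <-].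
    by rewrite lee_fin in_cones_le_upper //; apply: hP.
  apply/ereal_infP => _ [h /(FPFSP _ _ d1_gt0 d2_gt0)[_ hP] <-].
  by rewrite lee_fin in_cones_ge_lower //; apply: hP.
move=> hhat h Fhhat Fh.
(* The envelopes themselves need not be feasible, so the gap is bounded below by the difference of
   the feasible [H (1 - t)] and [H t], with t arbitrarily small. *)
have UL v : vrange d1 d2 za1 za2 v -> U v - L v <= Num.sqrt 2.
  move=> vr; apply: le_of_shrunk => [|t t0 t1]; first exact: ltW.
  rewrite -HB -lee_fin EFinB; apply: le_trans gap.
  apply: le_trans (ereal_sup_ubound _); last by exists v.
  by apply: leeB; [apply: ereal_sup_ubound|apply: ereal_inf_lbound];
    eexists => //; apply: FPFS_H; lra.
pose rho z := invmx (Wmx d1 d2) *m col2 (vc z) (h (vc z)).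
have [_ chat] := (FPFSP _ _ d1_gt0 d2_gt0 _ _ _ _).1 Fhhat.
have [_ ch] := (FPFSP _ _ d1_gt0 d2_gt0 _ _ _ _).1 Fh.
exists rho; split=> z /(Winv_curveP _ _ d1_gt0 d2_gt0)[vr qE]; first by exists (vc z).
apply/(boxP _ _ d1_gt0 d2_gt0).
have [vE' qE'] := (Wmx_col2 _ _ d1_gt0 d2_gt0 (rho z) _ _).1 erefl.
rewrite vE' qE' qE subrr normr0 add0r.
by apply: (in_cones_dist_lt _ _ _ _ _ _ _ _ sqrt2_gt0 (UL _ vr)); [apply: chat|apply: ch].
Qed.
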